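(* Let $k$ and $j$ be positive integers. In any graph $G$, every vertex belonging to a $k$-resolving set of $G$ of size $j$ has degree at most $3^{j-1}$. Moreover, for $k\ge 2$ this bound is sharp: for every positive integer $j$ there exist a graph $G$ and a $k$-resolving set of $G$ of size $j$ containing a vertex of degree $3^{j-1}$.
   Context: Graphs are finite, simple, undirected, possibly disconnected; $\textnormal{dist}(u,v)=\infty$ between different components. For a positive integer $k$, a set $S=\{v_1,\dots,v_j\}$ of vertices is a $k$-resolving set of $G$ if the vectors $(\min(k+1,\textnormal{dist}(u,v_1)),\dots,\min(k+1,\textnormal{dist}(u,v_j)))$ are pairwise distinct over $u\in V(G)$. *)

(* Defs.v *)
From mathcomp Require Import all_boot.

Set Implicit Arguments.
Unset Strict Implicit.
Unset Printing Implicit Defensive.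

Record sgraph := SGraph {
  vertex :> finType;
  adj : rel vertex;
  adj_sym : symmetric adj;
  adj_irrefl : irreflexive adj
}.

Section Graph.
Variable G : sgraph.
Implicit Types (u v : G) (n k : nat) (S : {set G}).

Definition degree v : nat := #|[set u | adj v u]|.

Definition walk n u v : bool :=
  [exists p : n.-tuple G, path (@adj G) u p && (last u p == v)].

Lemma connect_walk u v : connect (@adj G) u v -> exists n, walk n u v.
Proof.
case/connectP=> p up ->; exists (size p).
by apply/existsP; exists (in_tuple p); rewrite up eqxx.
Qed.

Lemma walk_connect n u v : walk n u v -> connect (@adj G) u v.
Proof. by case/existsP=> p /andP[up /eqP <-]; apply/connectP; exists p. Qed.

(* [None] stands for an infinite distance. *)
Definition dist u v : option nat :=
  match @idP (connect (@adj G) u v) with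
  | ReflectT uv => Some (ex_minn (connect_walk uv))
  | ReflectF _ => None
  end.

Lemma dist_someP u v n :
  dist u v = Some n <-> walk n u v /\ (forall m, walk m u v -> n <= m).
Proof.
rewrite /dist; case: {-}_ / idP => [uv|nuv].
  case: ex_minnP => m wm minm; split=> [[<-] // | [wn minn]].
  by congr Some; apply/eqP; rewrite eqn_leq minm ?minn.
by split=> // -[/walk_connect].
Qed.

Lemma dist_noneP u v : dist u v = None <-> forall n, ~~ walk n u v.
Proof.
split=> [|nw].
  rewrite /dist; case: {-}_ / idP => // nuv _ n.
  by apply/negP=> /walk_connect.
by case d: (dist u v) => [n|//]; case/dist_someP: d; rewrite (negPf (nw n)).
Qed.

(* min(k+1, dist(u,v)), which is k+1 when the distance is infinite *)
Definition tdist k u v : nat :=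
  if dist u v is Some d then minn k.+1 d else k.+1.

(* The vertices of S are listed in the order of [enum S]; pairwise
   distinctness of the vectors does not depend on the order chosen. *)
Definition resolving k S : Prop :=
  injective (fun u => [seq tdist k u v | v <- enum S]).

End Graph.

(* Main.v *)
Require Import Defs.
From mathcomp Require Import all_boot.
From mathcomp Require Import zify.

(** Truncated distances to a fixed landmark are 1-Lipschitz along edges, so for
    a neighbour u of v each of the j - 1 landmarks other than v sees one of
    three values, while v itself always sees 1; hence at most 3^(j-1)
    neighbours.  For sharpness, let v be joined to the words f in {0,1,2}^(j-1),
    join two words when they differ by at most 1 in every coordinate, and add
    for each coordinate i a landmark joined to the words with f i = 0.  Then the
    word f is at distance f i + 1 from landmark i, which needs the truncation
    level k + 1 to be at least 3. *)

Section Walks.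
Variable G : sgraph.
Implicit Types (u v w : G) (n k : nat) (S : {set G}).

Lemma walk0 u v : walk 0 u v = (u == v).
Proof.
apply/existsP/idP => [[p]|uv]; first by rewrite (tuple0 p).
by exists [tuple].
Qed.

Lemma walkS n u v : walk n.+1 u v = [exists w, adj u w && walk n w v].
Proof.
apply/existsP/existsP => [[p]|[w /andP[uw /existsP[p /andP[wp pv]]]]].
  case/tupleP: p => w p /= /andP[/andP[uw wp] pv].
  by exists w; rewrite uw; apply/existsP; exists p; rewrite wp.
by exists [tuple of w :: p]; rewrite /= uw wp.
Qed.

Lemma tdist_le_walk k n u v : walk n u v -> tdist k u v <= n.
Proof.
rewrite /tdist => wn; case E: (dist u v) => [d|].
  by move/dist_someP: E => [_ /(_ _ wn)]; apply: leq_trans (geq_minr _ _).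
by move/dist_noneP: E => /(_ n); rewrite wn.
Qed.

Lemma walk_tdist k u v : tdist k u v <= k -> walk (tdist k u v) u v.
Proof.
rewrite /tdist; case E: (dist u v) => [d|]; last by rewrite ltnn.
move/dist_someP: E => [wd _]; rewrite geq_min ltnn /= => dk.
by rewrite (minn_idPr _) // leqW.
Qed.

Lemma tdist_le k u v : tdist k u v <= k.+1.
Proof. by rewrite /tdist; case: dist => // d; apply: geq_minl. Qed.

Lemma tdist_eq0 k u v : (tdist k u v == 0) = (u == v).
Proof.
rewrite -walk0; apply/eqP/idP => [E|/(tdist_le_walk k)].
  by rewrite -[X in walk X]E; apply: walk_tdist; rewrite E.
by rewrite leqn0 => /eqP.
Qed.

(** Prepend the edge to a walk from [v] to [w]; if the value at [v] is already truncated, the cap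
    [k.+1] suffices. *)
Lemma tdist_adj k u v w : adj u v -> tdist k u w <= (tdist k v w).+1.
Proof.
move=> uv; case: (leqP (tdist k v w) k) => [/walk_tdist vw | kv].
  by apply: tdist_le_walk; rewrite walkS; apply/existsP; exists v; rewrite uv.
exact: leq_trans (tdist_le _ _ _) (leqW kv).
Qed.

Lemma tdist_adj1 k u v : 0 < k -> adj u v -> tdist k u v = 1.
Proof.
move=> k0 uv; apply/eqP; rewrite eqn_leq lt0n tdist_eq0.
apply/andP; split; last by apply: contraTneq uv => ->; rewrite adj_irrefl.
by apply: tdist_le_walk; rewrite walkS; apply/existsP; exists v; rewrite uv walk0 /=.
Qed.

Lemma resolvingP k S :
  resolving k S <->
  (forall u v, {in S, forall w, tdist k u w = tdist k v w} -> u = v).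
Proof.
split=> [res u v uv | inj u v uv].
  by apply: res; apply/eq_in_map => w; rewrite mem_enum => /uv.
by apply: inj => w wS; move/eq_in_map: uv; apply; rewrite mem_enum.
Qed.

(** A vertex of [S] is the only one at distance 0 from itself, so its own coordinate separates it
    from every other vertex. *)
Lemma resolving_outside k S :
  (forall u v, u \notin S -> v \notin S ->
     {in S, forall w, tdist k u w = tdist k v w} -> u = v) ->
  resolving k S.
Proof.
move=> inj; apply/resolvingP => u v uv.
case: (boolP (u \in S)) => uS.
  by apply/esym/eqP; rewrite -(tdist_eq0 k) -uv // tdist_eq0.
case: (boolP (v \in S)) => vS; last exact: inj.
by apply/eqP; rewrite -(tdist_eq0 k) uv // tdist_eq0.
Qed.

Lemma degree_resolving_le k S v :
  0 < k -> resolving k S -> v \in S -> degree v <= 3 ^ (#|S| - 1).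
Proof.
move=> k0 /resolvingP res vS.
(* The difference of the two distances, which lies in {-1, 0, 1}, shifted by one. *)
pose code u : {ffun {w | w \in S :\ v} -> 'I_3} :=
  [ffun w => inord ((tdist k u (val w)).+1 - tdist k v (val w))].
have code_inj : {in [set u | adj v u] &, injective code}.
  move=> u u'; rewrite !inE => vu vu' E; apply: res => w wS.
  have [->|wv] := eqVneq w v; first by rewrite !tdist_adj1 // adj_sym.
  have wSv : w \in S :\ v by rewrite !inE wv.
  move/ffunP/(_ (Sub w wSv)): E; rewrite !ffunE /= => /(congr1 val) /= {}E.
  (* The Lipschitz bound is needed in both directions: one keeps the natural subtraction exact, the
     other keeps its value below 3 for [inordK]. *)
  have := tdist_adj k _ _ w vu; have := tdist_adj k _ _ w vu'.
  rewrite adj_sym in vu; rewrite adj_sym in vu'.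
  have := tdist_adj k _ _ w vu; have := tdist_adj k _ _ w vu'.
  by move=> *; move: E; rewrite !inordK; lia.
rewrite /degree -(card_in_imset code_inj) (leq_trans (max_card _)) //.
by rewrite card_ffun card_ord card_sig (cardsD1 v S) vS add1n subn1.
Qed.

End Walks.

Section Extremal.
Variable m : nat.

(* [None] is the vertex of large degree, [Some (inl i)] the landmark of
   coordinate [i]. *)
Definition word_vertex : finType := option ('I_m + {ffun 'I_m -> 'I_3}).

Definition word_adj (a b : word_vertex) : bool :=
  match a, b with
  | None, Some (inr _) | Some (inr _), None => true
  | Some (inl i), Some (inr f) | Some (inr f), Some (inl i) => f i == ord0
  | Some (inr f), Some (inr g) =>
      (f != g) && [forall i, (f i <= (g i).+1) && (g i <= (f i).+1)]
  | _, _ => false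
  end.

Lemma word_adj_sym : symmetric word_adj.
Proof.
move=> [[i|f]|] [[j|g]|] //=; rewrite eq_sym; congr (_ && _).
by apply: eq_forallb => i; rewrite andbC.
Qed.

Lemma word_adj_irrefl : irreflexive word_adj.
Proof. by move=> [[i|f]|] //=; rewrite eqxx. Qed.

Definition word_graph : sgraph := SGraph word_adj_sym word_adj_irrefl.

Definition landmark (i : 'I_m) : word_graph := Some (inl i).
Definition word (f : {ffun 'I_m -> 'I_3}) : word_graph := Some (inr f).
Definition hub : word_graph := None.

(** A 1-Lipschitz potential vanishing at landmark [i], hence a lower bound for the distance to it.
    Words take the heights 1, 2 and 3, and 2 is the only value within 1 of all of them, which suits
    the hub and the other landmarks. *)
Definition landmark_height (i : 'I_m) (a : word_graph) : nat :=
  match a with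
  | Some (inl l) => if l == i then 0 else 2
  | Some (inr f) => (f i).+1
  | None => 2
  end.

Lemma landmark_height_adj i (a b : word_graph) :
  adj a b -> landmark_height i a <= (landmark_height i b).+1.
Proof.
case: a b => [[l|f]|] [[l'|g]|] //=.
- by case: ifP => // _ _; lia.
- case: (l' =P i) => [->|_ _]; last exact: ltn_ord.
  by move/eqP->.
- by case/andP=> _ /forallP/(_ i)/andP[].
Qed.

Lemma landmark_height_walk i n (a : word_graph) :
  walk n a (landmark i) -> landmark_height i a <= n.
Proof.
elim: n a => [|n IH] a.
  by rewrite walk0 => /eqP->; rewrite /= eqxx.
rewrite walkS => /existsP[b /andP[ab /IH bn]].
exact: leq_trans (landmark_height_adj i _ _ ab) _.
Qed.

(** Lowering the letter at [i] by one follows an edge; once it is 0, the landmark is adjacent. *)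
Lemma walk_word_landmark i (f : {ffun 'I_m -> 'I_3}) : walk (f i).+1 (word f) (landmark i).
Proof.
move En: (nat_of_ord (f i)) => n; elim: n f En => [|n IH] f fi.
  rewrite walkS; apply/existsP; exists (landmark i); rewrite walk0 eqxx andbT.
  by apply/eqP/val_inj.
have n3 : n < 3 by rewrite ltnW // -fi ltn_ord.
pose g := [ffun l => if l == i then Ordinal n3 else f l].
rewrite walkS; apply/existsP; exists (word g).
rewrite IH ?ffunE ?eqxx // andbT; apply/andP; split.
  by apply/eqP => fg; move: fi; rewrite fg ffunE eqxx /=; lia.
apply/forallP => l; rewrite ffunE; case: eqP => [->|_]; rewrite ?fi /=; lia.
Qed.

Lemma tdist_word_landmark k i (f : {ffun 'I_m -> 'I_3}) :
  2 <= k -> tdist k (word f) (landmark i) = (f i).+1.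
Proof.
move=> k2; apply/eqP; rewrite eqn_leq tdist_le_walk ?walk_word_landmark //=.
case: (leqP (tdist k (word f) (landmark i)) k) => [/walk_tdist|].
  exact: landmark_height_walk.
(* A truncated value exceeds [k], so it is at least 3, the largest possible [(f i).+1]. *)
by have := ltn_ord (f i); lia.
Qed.

Definition landmarks : {set word_graph} := hub |: [set landmark i | i : 'I_m].

Lemma card_landmarks : #|landmarks| = m.+1.
Proof.
rewrite cardsU1 card_imset ?card_ord; last by move=> i j [].
by rewrite (_ : hub \notin _) //; apply/imsetP => -[].
Qed.

Lemma landmark_in i : landmark i \in landmarks.
Proof. by rewrite setU1r ?imset_f. Qed.

Lemma notin_landmarksP (a : word_graph) :
  a \notin landmarks -> exists f, a = word f.
Proof.
case: a => [[i|f]|]; [by rewrite landmark_in | by exists f | by rewrite setU11].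
Qed.

(** Only words lie outside [landmarks], and their distances to the landmarks spell out their
    letters. *)
Lemma landmarks_resolving k : 2 <= k -> resolving k landmarks.
Proof.
move=> k2; apply: resolving_outside.
move=> _ _ /notin_landmarksP[f ->] /notin_landmarksP[g ->] fg.
congr (word _); apply/ffunP => i; apply/val_inj/succn_inj.
by rewrite -!(tdist_word_landmark _ _ _ k2) fg ?landmark_in.
Qed.

Lemma degree_hub : degree hub = 3 ^ m.
Proof.
rewrite /degree (_ : [set u | _] = [set word f | f : {ffun 'I_m -> 'I_3}]).
  by rewrite card_imset ?card_ffun ?card_ord // => f g [].
apply/setP => -[[i|f]|]; rewrite !inE /=; apply/esym.
- by apply/imsetP => -[].
- exact: imset_f.
- by apply/imsetP => -[].
Qed.

End Extremal.

Theorem theorem22 (k : nat) (k_gt0 : 0 < k) :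
  (forall (j : nat), 0 < j ->
     forall (G : sgraph) (S : {set G}) (v : G),
       resolving k S -> #|S| = j -> v \in S -> degree v <= 3 ^ (j - 1))
  /\
  (2 <= k ->
     forall (j : nat), 0 < j ->
       exists (G : sgraph) (S : {set G}) (v : G),
         [/\ resolving k S, #|S| = j, v \in S & degree v = 3 ^ (j - 1)]).
Proof.
split=> [j _ G S v res <- vS | k2 [//|m] _]; first exact: degree_resolving_le res vS.
exists (word_graph m), (landmarks m), (hub m); split.
- exact: landmarks_resolving.
- exact: card_landmarks.
- exact: setU11.
- by rewrite subn1 degree_hub.
Qed.
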